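(* The following statements hold. (a) For all even integers $k\ge2$ and all integers $n\ge k+1$, there is a connected $k$-regular graph with vertex set $\{1,2,\ldots,n\}$. (b) For all odd integers $k\ge3$ and all even integers $n\ge k+1$, there is a connected $k$-regular graph with vertex set $\{1,2,\ldots,n\}$. (c) For all odd integers $k\ge3$ and all odd integers $n\ge k+2$, there is a connected nearly $k$-regular graph with vertex set $\{1,2,\ldots,n\}$.
   Context: Graphs are finite, simple and undirected. A graph with vertex set $\{1,\ldots,n\}$ is $k$-regular if every vertex has degree exactly $k$. It is nearly $k$-regular if $n-1$ of its vertices have degree $k$ and the one remaining vertex has degree $k-1$. A graph is connected if any two of its vertices are joined by a path. *)

(* Defs.v *)
From mathcomp Require Import all_boot.

Set Implicit Arguments.
Unset Strict Implicit.
Unset Printing Implicit Defensive.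

(* A graph on a finite vertex set is given by its adjacency relation.
   The vertex set {1, ..., n} is represented by 'I_n, the ordinal i standing
   for the vertex i + 1. *)
Definition simple_graph (T : finType) (e : rel T) : Prop :=
  symmetric e /\ irreflexive e.

Definition degree (T : finType) (e : rel T) (x : T) : nat := #|[set y | e x y]|.

Definition regular (T : finType) (k : nat) (e : rel T) : Prop :=
  forall x, degree e x = k.

(* The degree condition at v is written (degree e v).+1 = k rather than
   degree e v = k.-1 because k.-1 is truncated at k = 0. *)
Definition nearly_regular (T : finType) (k : nat) (e : rel T) : Prop :=
  exists v, (degree e v).+1 = k /\ forall x, x != v -> degree e x = k.

Definition connected_graph (T : finType) (e : rel T) : Prop :=
  forall x y, exists p : seq T, path e x p /\ last x p = y.

(* Main.v *)
Require Import Defs.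
From mathcomp Require Import all_boot.
From mathcomp Require Import zify.

(** Put [m = k / 2] and [h = n / 2], and join two vertices when their cyclic
    distance modulo [n] lies in [1, m].  This is a connected [2m]-regular graph as
    soon as [2m < n].  For odd [k] the pairs [{i, i + h}] with [i < h] form a
    matching at cyclic distance [h > m], so adding them raises by one every
    degree, except that of the vertex [2h] when [n = 2h + 1]. *)

(** Here [d] is the absolute difference, as one of the truncated subtractions is zero; [n - m <= d]
    is the wrap-around case. Working on [nat] keeps adjacency within reach of [lia]. *)
Definition circ_adj (n m x y : nat) : bool :=
  let d := (x - y) + (y - x) in (0 < d <= m) || (n - m <= d).

Definition half_adj (h x y : nat) : bool :=
  ((x < h) && (y == x + h)) || ((y < h) && (x == y + h)).

Lemma sum_interval (n a b : nat) : \sum_(i < n) (a <= i < b : nat) = minn b n - a.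
Proof.
elim: n => [|n IHn]; first by rewrite big_ord0; lia.
by rewrite big_ord_recr /= IHn; lia.
Qed.

Lemma degree_sum (n : nat) (e : rel 'I_n) (x : 'I_n) :
  degree e x = \sum_(y < n) (e x y : nat).
Proof.
rewrite /degree -sum1_card [LHS]big_mkcond.
by apply: eq_bigr => y _; rewrite inE; case: (e x y).
Qed.

(* The neighbourhood of [x] is cut into four intervals: above and below [x],
   without and with wrap-around. *)
Lemma sum_circ_adj (n m x : nat) : m.*2 < n -> x < n ->
  \sum_(y < n) (circ_adj n m x y : nat) = m.*2.
Proof.
move=> mn xn.
have -> : \sum_(y < n) (circ_adj n m x y : nat) =
    \sum_(y < n) ((x.+1 <= y < (x + m).+1 : nat) + (x - m <= y < x : nat)
      + (x + (n - m) <= y < n : nat) + (0 <= y < (x + m).+1 - n : nat)).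
  (* As [m.*2 < n], the four intervals are disjoint; truncation empties those that do not occur. *)
  by apply: eq_bigr => y _; have := ltn_ord y; rewrite /circ_adj; lia.
by rewrite !big_split !sum_interval /=; lia.
Qed.

Lemma sum_half_adj (n x : nat) : x < n ->
  \sum_(y < n) (half_adj n./2 x y : nat) = (x != n./2.*2).
Proof.
move=> xn; have nE := odd_double_half n.
have [xh|hx] := ltnP x n./2.
  under eq_bigr => y _.
    have -> : half_adj n./2 x y = (x + n./2 <= y < (x + n./2).+1).
      by rewrite /half_adj; lia.
    over.
  by rewrite sum_interval; lia.
under eq_bigr => y _.
  (* The interval is the single point [x - n./2], or empty when [x = n./2.*2], whose candidate
     partner [n./2] is outside the lower half. *)
  have -> : half_adj n./2 x y = (x - n./2 <= y < x - n./2 + (x != n./2.*2)).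
    by rewrite /half_adj; lia.
  over.
by rewrite sum_interval; lia.
Qed.

(** A matched pair differs by [n./2], strictly between [m] and [n - m]. *)
Lemma circ_half_disjoint (n m x y : nat) : m < n./2 ->
  circ_adj n m x y -> half_adj n./2 x y = false.
Proof. by have := odd_double_half n; rewrite /circ_adj /half_adj; lia. Qed.

(** The edges between consecutive vertices form a path through all of ['I_n]; the induction is on
    the gap [y - x]. *)
Lemma connected_graph_succ (n : nat) (e : rel 'I_n) : symmetric e ->
  (forall x y : 'I_n, y = x.+1 :> nat -> e x y) -> connected_graph e.
Proof.
move=> esym esucc x y.
suff /connectP[p ep yE] : connect e x y by exists p.
have csym := sym_connect_sym esym.
wlog le_xy : x y / x <= y.
  by move=> W; case: (leqP x y) => [|/ltnW] /W //; rewrite csym.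
have [j jE] : exists j, y = x + j :> nat by exists (y - x); lia.
elim: j y jE {le_xy} => [|j IHj] y yE.
  by rewrite (_ : y = x) ?connect0 //; apply: val_inj => /=; lia.
have jn : x + j < n by have := ltn_ord y; lia.
apply: connect_trans (IHj (Ordinal jn) erefl) (connect1 (esucc _ _ _)).
by rewrite yE addnS.
Qed.

Definition circ_graph (n m : nat) : rel 'I_n := fun x y => circ_adj n m x y.

Definition circ_half_graph (n m : nat) : rel 'I_n :=
  fun x y => circ_adj n m x y || half_adj n./2 x y.

Lemma circ_graph_simple (n m : nat) : m.*2 < n -> simple_graph (@circ_graph n m).
Proof. by move=> mn; split=> [x y|x]; rewrite /circ_graph /circ_adj; lia. Qed.

Lemma circ_half_graph_simple (n m : nat) : m < n./2 ->
  simple_graph (@circ_half_graph n m).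
Proof.
move=> mn; have nE := odd_double_half n.
by split=> [x y|x]; rewrite /circ_half_graph /circ_adj /half_adj; lia.
Qed.

Lemma circ_graph_connected (n m : nat) : 0 < m -> m.*2 < n ->
  connected_graph (@circ_graph n m).
Proof.
move=> m0 mn; apply: connected_graph_succ => [|x y]; last first.
  by rewrite /circ_graph /circ_adj; lia.
by case: (@circ_graph_simple n m mn).
Qed.

Lemma circ_half_graph_connected (n m : nat) : 0 < m < n./2 ->
  connected_graph (@circ_half_graph n m).
Proof.
case/andP=> m0 mn; apply: connected_graph_succ => [|x y]; last first.
  by rewrite /circ_half_graph /circ_adj; lia.
by case: (@circ_half_graph_simple n m mn).
Qed.

Lemma degree_circ_graph (n m : nat) (x : 'I_n) : m.*2 < n ->
  degree (@circ_graph n m) x = m.*2.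
Proof. by move=> mn; rewrite degree_sum sum_circ_adj. Qed.

Lemma degree_circ_half_graph (n m : nat) (x : 'I_n) : m < n./2 ->
  degree (@circ_half_graph n m) x = m.*2 + (x != n./2.*2 :> nat).
Proof.
move=> mn; have nE := odd_double_half n.
rewrite degree_sum -(@sum_half_adj n x) // -(@sum_circ_adj n m x) //; last by lia.
rewrite -big_split; apply: eq_bigr => y _ /=; rewrite /circ_half_graph.
(* By disjointness the indicator of the union is the sum of the indicators. *)
by case: (boolP (circ_adj n m x y)) => [/(circ_half_disjoint _ _ _ _ mn) ->|].
Qed.

Theorem theorem3 :
  (forall k n : nat, ~~ odd k -> 2 <= k -> k + 1 <= n ->
     exists e : rel 'I_n, simple_graph e /\ connected_graph e /\ regular k e)
  /\
  (forall k n : nat, odd k -> 3 <= k -> ~~ odd n -> k + 1 <= n ->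
     exists e : rel 'I_n, simple_graph e /\ connected_graph e /\ regular k e)
  /\
  (forall k n : nat, odd k -> 3 <= k -> odd n -> k + 2 <= n ->
     exists e : rel 'I_n,
       simple_graph e /\ connected_graph e /\ nearly_regular k e).
Proof.
split; [|split] => k n kodd k_ge.
- move=> kn; have kE := odd_double_half k.
  have mn : k./2.*2 < n by lia.
  exists (@circ_graph n k./2); split; first exact: circ_graph_simple.
  split; first by apply: circ_graph_connected => //; lia.
  by move=> x; rewrite degree_circ_graph //; lia.
- move=> nodd kn; have kE := odd_double_half k; have nE := odd_double_half n.
  have mn : k./2 < n./2 by lia.
  exists (@circ_half_graph n k./2); split; first exact: circ_half_graph_simple.
  split; first by apply: circ_half_graph_connected; lia.
  (* For even [n], [n./2.*2 = n] is not a vertex, so no degree is exceptional. *)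
  by move=> x; have := ltn_ord x; rewrite degree_circ_half_graph //; lia.
- move=> nodd kn; have kE := odd_double_half k; have nE := odd_double_half n.
  (* Both [k] and [n] are odd, so [k + 2 <= n] says exactly this. *)
  have mn : k./2 < n./2 by lia.
  exists (@circ_half_graph n k./2); split; first exact: circ_half_graph_simple.
  split; first by apply: circ_half_graph_connected; lia.
  have hn : n./2.*2 < n by lia.
  (* The unmatched vertex is the last one, [n./2.*2 = n - 1]. *)
  exists (Ordinal hn); split=> [|x]; rewrite degree_circ_half_graph //=; first lia.
  by rewrite -val_eqE /=; lia.
Qed.
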